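(* Let $\mathbb{E}[W^2]<\infty$, fix an integer $q\ge3$, let $B=0$, and assume that $\mathscr{F}_0$ satisfies the unique zero-crossing condition. Let, for $t\ge0$, $$\mathscr{K}(t)=\frac{1}{\mathbb{E}[W]}\mathbb{E}\Big[\log\Big(\frac{\mathrm{e}^{tW}+q-1}{q}\Big)\Big]-\frac{q-1}{2q}\,t\,\mathscr{F}_0(t)-\frac tq.$$ Then there is a unique $t_c>0$ such that $\mathscr{K}(t_c)=0$. In terms of this $t_c$, the critical inverse temperature is $$\beta_c=\log\Big(1+\frac{t_c}{\mathscr{F}_0(t_c)}\Big),$$ and, furthermore, $s(\beta_c,0)=\mathscr{F}_0(t_c)$.
   Context: $W$ is a non-negative random variable with $\mathbb{E}[W]>0$ such that, for some $c>0$ and $\tau>2$, $\mathbb{P}(W>w)\le c\,w^{-(\tau-1)}$ for all $w\ge1$; it is the limiting weight of a rank-1 inhomogeneous random graph. For $t\ge0$, $$\mathscr{F}_0(t)=\mathbb{E}\Big[\frac{W}{\mathbb{E}[W]}\,\frac{\mathrm{e}^{tW}-1}{\mathrm{e}^{tW}+q-1}\Big].$$ Unique zero-crossing condition: there is a $t_*>0$ with $\mathscr{F}_0''(t)>0$ for $0<t<t_*$ and $\mathscr{F}_0''(t)<0$ for $t>t_*$. For $\beta>0$ and $\beta'=\mathrm{e}^\beta-1$, let $$p_{\beta,0}(s)=\mathbb{E}\big[\log(\mathrm{e}^{\beta'Ws}+q-1)\big]-\frac{\beta'\mathbb{E}[W]}{2q}\big[(q-1)s^2+2s-1\big],\quad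 s\in[0,1].$$ Under the hypotheses, the critical inverse temperature $\beta_c=\beta_c(0)\in(0,\infty)$ is the unique $\beta>0$ at which the maximizer of $p_{\beta,0}$ over $[0,1]$ is not unique: for $\beta<\beta_c$ the unique maximizer is $0$, for $\beta>\beta_c$ it is the largest solution $s$ of $\mathscr{F}_0(\beta's)=s$, which is positive; $s(\beta_c,0)$ denotes the non-zero maximizer of $p_{\beta_c,0}$. *)

(* Defs.v *)
From HB Require Import structures.
From mathcomp Require Import all_boot all_order all_algebra.
From mathcomp Require Import all_classical all_reals all_analysis.

Set Implicit Arguments.
Unset Strict Implicit.
Unset Printing Implicit Defensive.

Import Order.TTheory GRing.Theory Num.Theory.
Import numFieldNormedType.Exports.
Local Open Scope classical_set_scope.
Local Open Scope ring_scope.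

Section potts.
Context (d : measure_display) (T : measurableType d) (R : realType).
Context (P : probability T R) (W : {RV P >-> R}) (q : nat).

(* Real-valued expectation. If W >= 0 has finite mean, all the variables it is
   applied to below are integrable, so that [fine] loses nothing. *)
Definition mean (X : T -> R) : R := fine ('E_P[X])%E.

Definition F0 (t : R) : R :=
  mean (fun x => W x / mean W *
    ((expR (t * W x) - 1) / (expR (t * W x) + q%:R - 1))).

Definition unique_zero_crossing : Prop :=
  exists tstar : R, 0 < tstar /\
    (forall t : R, 0 < t -> t < tstar -> 0 < (F0^`(2))%classic t) /\
    (forall t : R, tstar < t -> (F0^`(2))%classic t < 0).

Definition K (t : R) : R :=
  (mean W)^-1 * mean (fun x => ln ((expR (t * W x) + q%:R - 1) / q%:R))
  - (q%:R - 1) / (2 * q%:R) * t * F0 t - t / q%:R.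

Definition pressure (beta s : R) : R :=
  mean (fun x => ln (expR ((expR beta - 1) * W x * s) + q%:R - 1))
  - (expR beta - 1) * mean W / (2 * q%:R) *
    ((q%:R - 1) * s ^+ 2 + 2 * s - 1).

Definition is_maximizer (beta s : R) : Prop :=
  (0 <= s <= 1) /\
  forall u : R, 0 <= u <= 1 -> pressure beta u <= pressure beta s.

Definition several_maximizers (beta : R) : Prop :=
  exists s1 s2 : R, s1 <> s2 /\ is_maximizer beta s1 /\ is_maximizer beta s2.

Definition is_largest_solution (beta s : R) : Prop :=
  0 <= s /\ F0 ((expR beta - 1) * s) = s /\
  forall u : R, 0 <= u -> F0 ((expR beta - 1) * u) = u -> u <= s.

Definition is_critical (betac : R) : Prop :=
  0 < betac /\
  several_maximizers betac /\
  (forall beta : R, 0 < beta -> several_maximizers beta -> beta = betac) /\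
  (forall beta : R, 0 < beta -> beta < betac ->
     forall s : R, is_maximizer beta s <-> s = 0) /\
  (forall beta : R, betac < beta ->
     exists s0 : R, 0 < s0 /\ is_largest_solution beta s0 /\
       forall s : R, is_maximizer beta s <-> s = s0).

Definition is_nonzero_maximizer (beta s : R) : Prop :=
  is_maximizer beta s /\ s <> 0.

End potts.

(* Main.v *)
(** Write F for F0, m for the mean of W and b = e^beta - 1.  Because
    e^x/(e^x+q-1) = 1/q + (q-1)/q * (e^x-1)/(e^x+q-1), the primitive G of F with
    G(0) = 0 is an affine function of E[log(e^(tW)+q-1)] and of t, and
      K(t) = (q-1)/q * (G(t) - t F(t)/2),
      p_(beta,0)(s) = C + m(q-1)/q * (G(bs) - (bs)^2/(2b)).
    As F'' changes sign once and 0 <= F <= 1, F(t)/t first increases and then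
    decreases, and H(t) = G(t) - t F(t)/2 decreases from 0 and then increases to
    infinity; so H has exactly one positive zero tc.  Since
    (G(t)/t^2)' = -2 H(t)/t^3, the quotient G(t)/t^2 has a strict maximum at tc,
    of value F(tc)/(2 tc).  Thus G(t) - t^2/(2b) is negative on t > 0 for
    b < tc/F(tc) and vanishes only at 0 and tc for b = tc/F(tc), while for
    b > tc/F(tc) its maximum is attained only at the last solution of
    F(t) = t/b. *)
Require Import Defs.
From HB Require Import structures.
From mathcomp Require Import all_boot all_order all_algebra.
From mathcomp Require Import all_classical all_reals all_analysis.
From mathcomp Require Import measurable_realfun.
From mathcomp Require Import ring lra.

Import Order.TTheory GRing.Theory Num.Theory.
Import numFieldNormedType.Exports.
Local Open Scope classical_set_scope.
Local Open Scope ring_scope.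

(** * Strict monotonicity from the sign of a derivative *)

Section monotonicity.
Context {R : realType}.
Implicit Types (f df : R -> R) (x y c : R).

Lemma is_derive_MVT f df x y : x < y ->
    (forall z, x <= z <= y -> is_derive z 1 f (df z)) ->
  exists2 c, x < c < y & f y - f x = df c * (y - x).
Proof.
move=> xy fdf.
have [z||c] := @MVT R f df x y xy.
- by rewrite in_itv/= => /andP[? ?]; apply: fdf; rewrite !ltW.
- apply: derivable_within_continuous => z; rewrite in_itv/= => zxy.
  by have [] := fdf _ zxy.
by rewrite in_itv/=; exists c.
Qed.

Lemma is_derive_gt0_lt f df x y : x < y ->
    (forall z, x <= z <= y -> is_derive z 1 f (df z)) ->
    (forall z, x < z < y -> 0 < df z) ->
  f x < f y.
Proof.
move=> xy fdf df0; have [c cxy E] := is_derive_MVT _ _ _ _ xy fdf.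
by rewrite -subr_gt0 E mulr_gt0 ?subr_gt0 ?df0.
Qed.

(** Splitting at [c] leaves two intervals whose interiors avoid [c]. The exceptional point serves
    the inflection point [ts] below, where no sign of the derivative is available. *)
Lemma is_derive_gt0_lt_except c f df x y : x < y ->
    (forall z, x <= z <= y -> is_derive z 1 f (df z)) ->
    (forall z, x < z < y -> z != c -> 0 < df z) ->
  f x < f y.
Proof.
move=> xy fdf df0; have [/andP[xc cy]|] := boolP (x < c < y).
  apply: (@lt_trans _ _ (f c)); apply: (is_derive_gt0_lt _ df) => // z zP.
  - by apply: fdf; lra.
  - by apply: df0; [lra|apply/eqP; lra].
  - by apply: fdf; lra.
  - by apply: df0; [lra|apply/eqP; lra].
rewrite negb_and -!leNgt => xcy.
apply: (is_derive_gt0_lt _ df) => // z zP; apply: df0 => //.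
by apply/eqP => zc; move: xcy zP; rewrite zc; lra.
Qed.

Lemma is_derive_lt0_lt_except c f df x y : x < y ->
    (forall z, x <= z <= y -> is_derive z 1 f (df z)) ->
    (forall z, x < z < y -> z != c -> df z < 0) ->
  f y < f x.
Proof.
move=> xy fdf df0; rewrite -ltrN2.
apply: (is_derive_gt0_lt_except c (fun z => - f z) (fun z => - df z)) => //.
  by move=> z /fdf fz; exact: is_deriveN.
by move=> z zP zc; rewrite oppr_gt0; exact: df0.
Qed.

Lemma is_derive_lt0_lt f df x y : x < y ->
    (forall z, x <= z <= y -> is_derive z 1 f (df z)) ->
    (forall z, x < z < y -> df z < 0) ->
  f y < f x.
Proof.
by move=> xy fdf df0; apply: (is_derive_lt0_lt_except x f df) => // z /df0.
Qed.

End monotonicity.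

(** * Sigmoid functions and the equal-area rule *)

Section sigmoid.
Context {R : realType}.
Variables (F F' F'' G : R -> R) (ts : R).
Hypothesis dF : forall t : R, is_derive t 1 F (F' t).
Hypothesis dG : forall t : R, is_derive t 1 G (F t).
Hypothesis F_0 : F 0 = 0.
Hypothesis G_0 : G 0 = 0.
Hypothesis F_ge0 : forall t : R, 0 <= t -> 0 <= F t.
Hypothesis F_le1 : forall t : R, 0 <= t -> F t <= 1.
Hypothesis ts_gt0 : 0 < ts.
Hypothesis dF'_lt : forall t : R, 0 < t < ts ->
  is_derive t 1 F' (F'' t) /\ 0 < F'' t.
Hypothesis dF'_gt : forall t : R, ts < t ->
  is_derive t 1 F' (F'' t) /\ F'' t < 0.

(** The tangent to [F] at [t] meets the vertical axis at height [D t]; its sign governs both the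
    growth of [H] and the decay of [phi]. [H t] is the signed area between the graph of [F] and its
    chord over [[0, t]]. *)
Let D t := F t - t * F' t.
Let H t := G t - t * F t / 2.
Let phi t := F t / t.
Let psi t := G t / t ^+ 2.

Let dH (t : R) : is_derive t 1 H (D t / 2).
Proof.
have ? := dF t; have ? := dG t.
apply: is_derive_eq; rewrite /D /GRing.scale/=; lra.
Qed.

Let dphi (t : R) : 0 < t -> is_derive t 1 phi (- D t / t ^+ 2).
Proof.
move=> t0; have t0' : t != 0 by rewrite gt_eqF.
have ? := dF t.
have ? : is_derive t 1 (fun x : R => x^-1) (- t ^- 2).
  by apply: is_derive_eq; [exact: is_deriveV|rewrite /GRing.scale/=; lra].
apply: is_derive_eq; rewrite /D /GRing.scale/=; field.
by rewrite t0'.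
Qed.

Let dpsi (t : R) : 0 < t -> is_derive t 1 psi (- 2 * H t / t ^+ 3).
Proof.
move=> t0; have t0' : t != 0 by rewrite gt_eqF.
have ? := dG t.
have ? : is_derive t 1 (fun x : R => (x ^+ 2)^-1) (- 2 * t * (t ^+ 2) ^- 2).
  apply: is_derive_eq; first by apply: is_deriveV; rewrite expf_neq0.
  rewrite /GRing.scale/=; ring.
apply: is_derive_eq; rewrite /H /GRing.scale/=; field.
by rewrite t0'.
Qed.

(** The mean value theorem and [F 0 = 0] give [F t = t * F' c] with [0 < c < t], and [F'] increases
    on []0, ts[]. *)
Let D_lt0 t : 0 < t < ts -> D t < 0.
Proof.
move=> tP; have t0 : 0 < t by lra.
have [c cP] := is_derive_MVT F F' 0 t t0 (fun z _ => dF z).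
rewrite F_0 !subr0 /D => ->.
have : F' c < F' t.
  apply: (is_derive_gt0_lt F' F''); first by lra.
    by move=> z zP; apply: (dF'_lt _ _).1; lra.
  by move=> z zP; apply: (dF'_lt _ _).2; lra.
by move=> ct; rewrite (mulrC t) -mulrBl pmulr_llt0// subr_lt0.
Qed.

Let D_incr x y : ts < x -> x < y -> D x < D y.
Proof.
have ts0 := ts_gt0.
move=> tsx xy.
apply: (is_derive_gt0_lt D (fun t => - t * F'' t)) => // z zP.
  have ? := dF z; have [|? _] := dF'_gt z; first by lra.
  by apply: is_derive_eq; rewrite /GRing.scale/=; ring.
have [|_ Fz] := dF'_gt z; first by lra.
have z0 : 0 < z by lra.
by rewrite mulNr -mulrN mulr_gt0 ?oppr_gt0.
Qed.

Let phi_ts : 0 < phi ts.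
Proof.
have ts0 := ts_gt0.
have h0 : 0 < ts / 2 by lra.
apply: (@le_lt_trans _ _ (phi (ts / 2))).
  by rewrite divr_ge0 ?F_ge0 ?ltW.
apply: (is_derive_gt0_lt phi (fun t => - D t / t ^+ 2)); first lra.
  by move=> z zP; apply: dphi; lra.
move=> z zP; rewrite divr_gt0 ?oppr_gt0 ?D_lt0 ?exprn_gt0//; lra.
Qed.

(** Otherwise [D] is negative beyond [ts], so [phi] stays above [phi ts > 0] there and [F] grows at
    least linearly, against [F <= 1]. *)
Let D_pos : exists2 t, ts < t & 0 < D t.
Proof.
have ts0 := ts_gt0.
apply: contrapT => /forall2NP noD.
have {}noD t : ts < t -> D t < 0.
  move=> tst; apply: (@lt_le_trans _ _ (D (t + 1))).
    by apply: D_incr; lra.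
  by have [] := noD (t + 1); [lra|move/negP; rewrite -leNgt].
(* The first entry puts [t] beyond [ts]; the second makes [t * phi ts] at least 2, whereas
   [F t <= 1]. *)
pose t := Num.max (ts + 1) (2 / phi ts).
have tst : ts < t by rewrite /t lt_max; apply/orP; left; lra.
have : phi ts < phi t.
  apply: (is_derive_gt0_lt phi (fun t => - D t / t ^+ 2)) => // z zP.
    by apply: dphi; lra.
  rewrite divr_gt0 ?oppr_gt0 ?noD ?exprn_gt0//; lra.
apply/negP; rewrite -leNgt ler_pdivrMr; last by lra.
apply: (le_trans (F_le1 _ _)); first by lra.
have : 2 / phi ts <= t by rewrite /t le_max lexx orbT.
by rewrite ler_pdivrMr// mulrC; lra.
Qed.

(* The sign of [D ts] is left open: [F''] is not controlled at [ts] itself. *)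
Let D_sign : exists t1, [/\ ts <= t1,
    forall t : R, 0 < t < t1 -> t != ts -> D t < 0 &
    forall t : R, t1 < t -> 0 < D t].
Proof.
pose A := [set t | ts < t /\ 0 < D t].
have [a ats Da] := D_pos.
have hA : has_inf A.
  by split; [exists a|exists ts => t [/ltW]].
exists (inf A); split.
- by apply: lb_le_inf; [exact: hA.1|move=> t [/ltW]].
- move=> t /andP[t0 tA]; rewrite neq_lt => /orP[tts|tst].
    by apply: D_lt0; rewrite t0.
  (* The midpoint lies beyond [ts] but below [inf A], hence outside [A]: [D] is at most 0 there and
     strictly smaller at [t]. *)
  apply: (@lt_le_trans _ _ (D ((t + inf A) / 2))).
    by apply: D_incr; lra.
  rewrite leNgt; apply/negP => Dt.
  have : inf A <= (t + inf A) / 2.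
    by apply: (ge_inf hA.2); split => //; lra.
  lra.
- move=> t /(inf_lt hA.1)[b [tsb Db]] bt.
  by apply: (lt_trans Db); exact: D_incr.
Qed.

(** [G tc = tc * F tc / 2] is Maxwell's equal-area rule: the graph of [F] and its chord over
    [[0, tc]] enclose the same area above the axis. In the last clause, [F t = t / b] is
    stationarity of [G t - t ^+ 2 / (2 * b)]. *)
Lemma sigmoid_maxwell : exists tc,
  [/\ [/\ 0 < tc, 0 < F tc & G tc = tc * F tc / 2],
    forall t : R, 0 < t -> G t = t * F t / 2 -> t = tc,
    forall t : R, 0 < t -> t != tc -> G t / t ^+ 2 < F tc / (2 * tc) &
    forall b, tc / F tc < b -> exists t0,
      [/\ 0 < t0 <= b, F t0 = t0 / b,
          forall t : R, 0 <= t -> F t = t / b -> t <= t0 &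
          forall t : R, 0 <= t -> t != t0 ->
            G t - t ^+ 2 / (2 * b) < G t0 - t0 ^+ 2 / (2 * b)]].
Proof.
have ts0 := ts_gt0.
have [t1 [tst1 Dn Dp]] := D_sign.
have t1_gt0 : 0 < t1 by lra.
have phi_incr x y : 0 < x -> x < y -> y <= t1 -> phi x < phi y.
  move=> x0 xy yt1.
  apply: (is_derive_gt0_lt_except ts phi (fun t => - D t / t ^+ 2)) => //.
    by move=> z zP; apply: dphi; lra.
  move=> z zP zts; rewrite divr_gt0 ?oppr_gt0 ?Dn ?exprn_gt0//; lra.
have phi_decr x y : t1 <= x -> x < y -> phi y < phi x.
  move=> t1x xy.
  apply: (is_derive_lt0_lt phi (fun t => - D t / t ^+ 2)) => //.
    by move=> z zP; apply: dphi; lra.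
  move=> z zP; rewrite mulNr oppr_lt0 divr_gt0 ?Dp ?exprn_gt0//; lra.
have H_decr x y : 0 <= x -> x < y -> y <= t1 -> H y < H x.
  move=> x0 xy yt1.
  apply: (is_derive_lt0_lt_except ts H (fun t => D t / 2)) => //.
  by move=> z zP zts; rewrite pmulr_llt0// Dn//; lra.
have H_incr x y : t1 <= x -> x < y -> H x < H y.
  move=> t1x xy.
  apply: (is_derive_gt0_lt H (fun t => D t / 2)) => //.
  by move=> z zP; rewrite divr_gt0// Dp//; lra.
have H_0 : H 0 = 0 by rewrite /H G_0 F_0; lra.
have [tc t1tc Htc] : exists2 tc, t1 < tc & H tc = 0.
  have Ht1 : H t1 < 0 by rewrite -H_0; exact: H_decr.
  pose a := t1 + 1; have t1a : t1 < a by rewrite /a; lra.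
  have Da : 0 < D a by exact: Dp.
  (* On [[a, y]] the slope of [H] is at least [D a / 2]; this length makes the gain exceed [|H a|],
     so that [H y > 0]. *)
  pose y := a + 1 + 2 * `|H a| / D a.
  have ay : a < y.
    suff : 0 <= 2 * `|H a| / D a by rewrite /y; lra.
    by rewrite divr_ge0 ?mulr_ge0// ltW.
  have Hy : 0 < H y.
    have [c /andP[ac cy] Hya] := is_derive_MVT H _ _ _ ay (fun z _ => dH z).
    have DaDc : D a < D c by apply: D_incr; lra.
    have : D a * (y - a) < D c * (y - a) by rewrite ltr_pM2r ?subr_gt0.
    have -> : D a * (y - a) = D a + 2 * `|H a|.
      by rewrite /y; field; rewrite gt_eqF.
    by move: (ler_norm (- H a)) Hya; rewrite normrN; lra.
  have t1y : t1 <= y by lra.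
  have [||tc] := @IVT R H t1 y 0 t1y.
  - apply: derivable_within_continuous => z _.
    by have [] := dH z.
  - by rewrite ge_min le_max (ltW Ht1) (ltW Hy) orbT.
  - rewrite in_itv/= => /andP[t1tc _] Htc; exists tc => //.
    rewrite lt_neqAle t1tc andbT; apply/eqP => E.
    by move: Ht1; rewrite E Htc ltxx.
have tc_gt0 : 0 < tc by lra.
have H_lt0 t : 0 < t < tc -> H t < 0.
  move=> /andP[t_gt0 ttc]; have [tt1|t1t] := leP t t1.
    by rewrite -H_0; exact: H_decr.
  by rewrite -Htc; apply: H_incr => //; lra.
have H_gt0 t : tc < t -> 0 < H t.
  by move=> tct; rewrite -Htc; apply: H_incr => //; lra.
have Gtc : G tc = tc * F tc / 2 by move: Htc; rewrite /H; lra.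
have psi_tc : psi tc = F tc / (2 * tc).
  by rewrite /psi Gtc; field; rewrite gt_eqF.
have psi_lt t : 0 < t -> t != tc -> psi t < psi tc.
  move=> t_gt0; rewrite neq_lt => /orP[ttc|tct].
    apply: (is_derive_gt0_lt psi (fun t => - 2 * H t / t ^+ 3)) => // z zP.
      by apply: dpsi; lra.
    have Hz : H z < 0 by apply: H_lt0; lra.
    by rewrite divr_gt0 ?exprn_gt0//; lra.
  apply: (is_derive_lt0_lt psi (fun t => - 2 * H t / t ^+ 3)) => // z zP.
    by apply: dpsi; lra.
  have Hz : 0 < H z by apply: H_gt0; lra.
  by rewrite !mulNr oppr_lt0 divr_gt0 ?exprn_gt0//; lra.
(* [psi tc] strictly exceeds [psi (tc / 2) >= 0], and it is a positive multiple of [F tc]. *)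
have Ftc : 0 < F tc.
  have G_ge0 : 0 <= G (tc / 2).
    have h : 0 < tc / 2 by lra.
    have [c /andP[c0 _]] := is_derive_MVT G _ _ _ h (fun z _ => dG z).
    rewrite G_0 !subr0 => ->.
    by rewrite mulr_ge0 ?F_ge0 ?ltW.
  have : 0 < psi tc.
    apply: (@le_lt_trans _ _ (psi (tc / 2))).
      by rewrite divr_ge0// exprn_ge0//; lra.
    by apply: psi_lt; [lra|apply/eqP; lra].
  by rewrite psi_tc pmulr_lgt0// invr_gt0; lra.
exists tc; split => //.
- move=> t t_gt0 Gt; have Ht : H t = 0 by rewrite /H Gt; lra.
  have [ttc|tct|//] := ltgtP t tc.
    by have := H_lt0 t; rewrite t_gt0 ttc Ht ltxx => /(_ isT).
  by have := H_gt0 t tct; rewrite Ht ltxx.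
- by rewrite -psi_tc.
move=> b; rewrite ltr_pdivrMr// => tcb.
have b_gt0 : 0 < b.
  by rewrite -(pmulr_lgt0 _ Ftc); exact: lt_trans tcb.
have tc_le_b : tc <= b.
  by rewrite (le_trans (ltW tcb))// ler_piMr ?F_le1// ltW.
(* [phi] crosses the level [1 / b] on [[tc, b]]: it is above at [tc] because [tc / F tc < b], and
   not above at [b] because [F b <= 1]. As [phi] decreases beyond [t1 < tc], the crossing is the
   last one. *)
have phi_tc : b^-1 < phi tc.
  by rewrite /phi ltr_pdivlMr// mulrC ltr_pdivrMr// mulrC.
have phi_b : phi b <= b^-1.
  by rewrite /phi ler_piMl ?F_le1 ?invr_ge0 ?ltW.
have [||t0] := @IVT R phi tc b b^-1 tc_le_b.
- apply: derivable_within_continuous => z; rewrite in_itv/= => /andP[tcz _].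
  by have [] := dphi z (lt_le_trans tc_gt0 tcz).
- by rewrite ge_min le_max phi_b (ltW phi_tc) orbT.
rewrite in_itv/= => /andP[tct0 t0b] phi_t0.
have t0_gt0 : 0 < t0 by lra.
have phi_lt t : t0 < t -> phi t < b^-1.
  by move=> t0t; rewrite -phi_t0; apply: phi_decr => //; lra.
have phi_gt t : t1 <= t -> t < t0 -> b^-1 < phi t.
  by move=> t1t tt0; rewrite -phi_t0; exact: phi_decr.
pose Phi t := G t - t ^+ 2 / (2 * b).
pose dPhi t := F t - t / b.
have Phi_der (t : R) : is_derive t 1 Phi (dPhi t).
  have ? := dG t; apply: is_derive_eq; rewrite /dPhi /GRing.scale/=.
  by field; rewrite gt_eqF.
have dPhiE t : 0 < t -> dPhi t = t * (phi t - b^-1).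
  by move=> t_gt0; rewrite /dPhi /phi; field; rewrite !gt_eqF.
(* The equal-area identity turns the value of [Phi] at [tc] into a multiple of its slope there,
   which is positive. *)
have Phi_tc : 0 < Phi tc.
  have -> : Phi tc = tc * dPhi tc / 2.
    by rewrite /Phi /dPhi Gtc; field; rewrite gt_eqF.
  by rewrite dPhiE// divr_gt0// !mulr_gt0// subr_gt0.
have Phi_incr x y : t1 <= x -> x < y -> y <= t0 -> Phi x < Phi y.
  move=> t1x xy yt0; apply: (is_derive_gt0_lt Phi dPhi) => // z zP.
  have z_gt0 : 0 < z by lra.
  by rewrite dPhiE// mulr_gt0// subr_gt0; apply: phi_gt; lra.
exists t0; split.
- by rewrite t0_gt0.
- by rewrite -phi_t0 /phi mulrC divfK ?gt_eqF.
- move=> t t_ge0 Ft; rewrite leNgt; apply/negP => t0t.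
  have := phi_lt _ t0t; rewrite /phi Ft mulrAC divff ?mul1r ?ltxx//.
  by rewrite gt_eqF//; lra.
move=> t t_ge0; rewrite -/(Phi t) -/(Phi t0) neq_lt.
move=> /orP[tt0|t0t]; last first.
  apply: (is_derive_lt0_lt Phi dPhi) => // z zP.
  have z_gt0 : 0 < z by lra.
  by rewrite dPhiE// pmulr_rlt0// subr_lt0; apply: phi_lt; lra.
(* Left of [t1], [phi] increases. If [phi t <= 1 / b], then [Phi] has decreased from 0 up to [t] and
   is beaten by [Phi tc > 0]; if [phi t > 1 / b], then [Phi] increases from [t] through [t1] to
   [t0]. *)
have [t1t|tt1] := leP t1 t; first exact: Phi_incr.
have [phit|phit] := leP (phi t) b^-1.
  apply: (@le_lt_trans _ _ 0); last first.
    apply: (lt_le_trans Phi_tc).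
    move: tct0; rewrite le_eqVlt => /orP[/eqP ->//|tct0].
    by rewrite ltW// Phi_incr// ltW.
  have Phi_0 : Phi 0 = 0 by rewrite /Phi G_0; ring.
  move: t_ge0; rewrite le_eqVlt => /orP[/eqP <-|t_gt0]; first by rewrite Phi_0.
  rewrite -Phi_0 ltW//; apply: (is_derive_lt0_lt Phi dPhi) => // z zP.
  have z_gt0 : 0 < z by lra.
  rewrite dPhiE// pmulr_rlt0// subr_lt0 (lt_le_trans _ phit)//.
  by apply: phi_incr; lra.
(* At 0 the quotient [phi] evaluates to 0, which is not above [1 / b]. *)
have t_gt0 : 0 < t.
  rewrite lt_neqAle t_ge0 andbT; apply: contraTneq phit => <-.
  by rewrite /phi F_0 mul0r -leNgt invr_ge0 ltW.
apply: (@lt_trans _ _ (Phi t1)); last by apply: Phi_incr => //; lra.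
apply: (is_derive_gt0_lt Phi dPhi) => // z zP.
have z_gt0 : 0 < z by lra.
rewrite dPhiE// mulr_gt0// subr_gt0 (lt_trans phit)//.
by apply: phi_incr; lra.
Qed.
End sigmoid.

(** * Existence of derivatives and measurability *)

(* [derive1] takes the junk value [0] where the derivative does not exist. *)
Lemma is_derive_derive1n2 (R : realType) (f : R -> R) (x : R) :
  derive1n 2 f x != 0 -> is_derive x 1 (derive1 f) (derive1n 2 f x).
Proof.
rewrite derive1nS derive1n1 derive1E => ddf; apply: derivableP.
by apply: contra_neqP ddf => ndf; exact: dvgP ndf.
Qed.

Lemma is_derive_measurable (R : realType) (f df : R -> R) :
  (forall x : R, is_derive x 1 f (df x)) -> measurable_fun setT f.
Proof.
move=> fdf; apply: continuous_measurable_fun => x.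
by apply/differentiable_continuous/derivable1_diffP; have [] := fdf x.
Qed.

(** * The integrands and their bounds *)

Section logistic.
Context {R : realType} (r : R).
Hypothesis r_ge2 : 2 <= r.
Implicit Types u : R.

Let den_gt0 u : 0 < expR u + r - 1.
Proof. by have := r_ge2; have := expR_gt0 u; lra. Qed.

(** With [u = t * W], this is the factor that multiplies [W / mean W] in [F0]. *)
Definition logistic u := (expR u - 1) / (expR u + r - 1).

Definition dlogistic u := r * expR u / (expR u + r - 1) ^+ 2.

Lemma is_derive_logistic u : is_derive u 1 logistic (dlogistic u).
Proof.
have den0 := lt0r_neq0 (den_gt0 u).
apply: is_derive_eq; rewrite /dlogistic /GRing.scale/=.
by field.
Qed.

Lemma is_derive_log_partition u :
  is_derive u 1 (fun v => ln (expR v + r - 1))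
    (1 / r + (r - 1) / r * logistic u).
Proof.
have r2 := r_ge2.
have ? := is_derive1_ln (den_gt0 u).
have -> : (fun v => @ln R (expR v + r - 1)) =
    @ln R \o (fun v => expR v + r - 1) by [].
apply: is_derive_eq; rewrite /logistic.
by field; rewrite (lt0r_neq0 (den_gt0 u))/=; apply/eqP; lra.
Qed.

Lemma logistic_0 : logistic 0 = 0.
Proof. by rewrite /logistic expR0 subrr mul0r. Qed.

Lemma logistic_ge0 u : 0 <= u -> 0 <= logistic u.
Proof. move=> u0; apply: divr_ge0; last exact: ltW.
by rewrite subr_ge0 -expR0 ler_expR. Qed.

Lemma logistic_norm_le1 u : `|logistic u| <= 1.
Proof.
have r2 := r_ge2; have e0 := expR_gt0 u.
rewrite normf_div (gtr0_norm (den_gt0 u)) ler_pdivrMr// ler_norml; apply/andP.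
by split; lra.
Qed.

Lemma dlogistic_norm_le u : `|dlogistic u| <= 2.
Proof.
have r2 := r_ge2; have e0 := expR_gt0 u; have d0 := den_gt0 u.
have r0 : 0 < r by lra.
rewrite /dlogistic ger0_norm; last first.
  by rewrite divr_ge0 ?exprn_ge0 ?mulr_ge0 ?ltW.
(* Here [r <= 2 * (r - 1)], and both [r - 1] and [expR u] are at most the denominator. *)
rewrite ler_pdivrMr ?exprn_gt0//; nra.
Qed.

(** From [expR u + r - 1 <= r * expR |u|]. For [u = t * W] the bound is integrable as soon as [W]
    is. *)
Lemma log_partition_norm_le u : `|ln (expR u + r - 1)| <= ln r + `|u|.
Proof.
have r2 := r_ge2; have e0 := expR_gt0 u; have r0 : 0 < r by lra.
have n0 : 0 < expR `|u| by exact: expR_gt0.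
rewrite ger0_norm; last by apply: ln_ge0; lra.
rewrite -[`|u|]expRK -lnM ?posrE// ler_ln ?posrE ?mulr_gt0//.
have : 1 <= expR `|u| by rewrite -expR0 ler_expR.
have : expR u <= expR `|u| by rewrite ler_expR ler_norm.
by nra.
Qed.

End logistic.

(** * Differentiation under the expectation *)

Section mean.
Context {d : measure_display} {T : measurableType d} {R : realType}.
Context (P : probability T R).
Implicit Types f g X : T -> R.

Lemma meanE X : mean P X = \int[P]_x X x.
Proof. by rewrite /mean unlock. Qed.

Lemma mean_cst (c : R) : mean P (fun=> c) = c.
Proof. by rewrite /mean [X in fine X](expectation_cst P c). Qed.

Lemma dominated_integrable f g : measurable_fun setT f ->
  (forall x, `|f x| <= g x) -> P.-integrable setT (EFin \o g) ->
  P.-integrable setT (EFin \o f).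
Proof.
move=> mf fg; apply: le_integrable => //; first exact/measurable_EFinP.
by move=> x _ /=; rewrite lee_fin (le_trans (fg x))// ler_norm.
Qed.

(** Dominated differentiation under the integral, applied on the interval []t - 1, t + 1[]. One
    envelope for all [t] is affordable since the derivatives below are bounded multiples of [W] or
    [W ^+ 2]. *)
Lemma is_derive_mean (f df : R -> T -> R) (g : T -> R) :
    (forall t, P.-integrable setT (EFin \o f t)) ->
    (forall (t : R) x, is_derive t 1 (f ^~ x) (df t x)) ->
    P.-integrable setT (EFin \o g) ->
    (forall t x, `|df t x| <= g x) ->
  forall t : R, is_derive t 1 (fun s => mean P (f s)) (mean P (df t)).
Proof.
move=> intf fdf intg dfg t.
have d1 s x : partial1of2 f s x = df s x.
  by rewrite partial1of2E; have [] := fdf s x.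
have tI : `]t - 1, t + 1[%classic t by rewrite /= in_itv/=; lra.
have meanF : (fun s => mean P (f s)) = (fun s => \int[P]_x f s x).
  by apply/funext => s; rewrite meanE.
have f1 s x : `]t - 1, t + 1[%classic s -> [set: T] x -> derivable (f ^~ x) s 1.
  by move=> _ _; have [] := fdf s x.
have g0 x : 0 <= g x by exact: le_trans (dfg 0 x).
have f1g s x : `]t - 1, t + 1[%classic s -> [set: T] x ->
  `|partial1of2 f s x| <= g x by rewrite d1.
rewrite meanF; apply: DeriveDef.
  exact: (derivable_under_integral measurableT tI (fun s _ => intf s) f1 g0
    intg f1g).
rewrite -derive1E.
rewrite (differentiation_under_integral measurableT tI (fun s _ => intf s) f1 g0
  intg f1g).
by rewrite meanE; apply: eq_Rintegral => x _; rewrite d1.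
Qed.

End mean.

(** * Expressing [F0], [K] and the pressure through a primitive of [F0] *)

Section potts_functions_def.
Context {d : measure_display} {T : measurableType d} {R : realType}.
Context {P : probability T R} (W : {RV P >-> R}) (q : nat).

Definition log_partition (t : R) : R :=
  mean P (fun x => ln (expR (t * W x) + q%:R - 1)).

(** Obtained by solving [L' = m * (1 / q + (q - 1) / q * F0)] for [F0], where [L] is [log_partition]
    and [m] the mean of [W], and integrating from 0; [ln q] is the value of [L] at 0. *)
Definition F0_primitive (t : R) : R :=
  q%:R / (q%:R - 1) * ((log_partition t - ln q%:R) / mean P W - t / q%:R).

End potts_functions_def.

Section potts_functions.
Context {d : measure_display} {T : measurableType d} {R : realType}.
Context (P : probability T R) (W : {RV P >-> R}) (q : nat).
Hypothesis W_ge0 : forall x : T, 0 <= W x.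
Hypothesis EW_gt0 : (0 < 'E_P[W])%E.
Hypothesis EW2_fin : ('E_P[(fun x => (W x ^+ 2)%R)] < +oo)%E.
Hypothesis q_ge2 : (2 <= q)%N.

Local Notation r := (q%:R : R).
Local Notation m := (mean P W).
Local Notation L := (log_partition W q).
Local Notation G := (F0_primitive W q).

Let r_ge2 : 2 <= r. Proof. by rewrite (ler_nat R 2). Qed.

Let mW : measurable_fun [set: T] W. Proof. exact: measurable_funPT. Qed.

Let W2_integrable : P.-integrable setT (EFin \o (fun x => W x ^+ 2)).
Proof.
apply/integrableP; split.
  by apply/measurable_EFinP; exact: measurable_funX.
have := EW2_fin; rewrite unlock; congr (_ < _)%E; apply: eq_integral => x _.
by rewrite /= ger0_norm ?sqr_ge0.
Qed.

Let W_integrable : P.-integrable setT (EFin \o W).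
Proof.
(* The second moment controls the first through [(W - 1) ^+ 2 >= 0]. *)
apply: (@dominated_integrable _ _ _ _ _ (fun x => 1 + W x ^+ 2)) => //.
  by move=> x; rewrite ger0_norm//; have := sqr_ge0 (W x - 1); nra.
exact: (integrableD measurableT (finite_measure_integrable_cst P 1 measurableT)
  W2_integrable).
Qed.

Lemma mean_gt0 : 0 < m.
Proof.
have : 'E_P[W]%E = m%:E.
  rewrite /mean fineK// unlock; exact: integrable_fin_num.
by move: EW_gt0 => /[swap] ->; rewrite lte_fin.
Qed.

Let logistic_integrable t :
  P.-integrable setT (EFin \o (fun x => W x * logistic r (t * W x))).
Proof.
apply: (dominated_integrable _ _ W) => //.
  apply: measurable_funM => //.
  apply: (measurableT_comp
    (is_derive_measurable _ _ _ (is_derive_logistic r r_ge2))).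
  exact: measurable_funM.
move=> x; rewrite normrM (ger0_norm (W_ge0 x)) ler_piMr//.
exact: logistic_norm_le1.
Qed.

Lemma is_derive_scale (f df : R -> R) (t w : R) :
  is_derive (t * w) 1 f (df (t * w)) ->
  is_derive t 1 (fun s => f (s * w)) (w * df (t * w)).
Proof.
move=> fdf.
have -> : (fun s => f (s * w)) = f \o (fun s => s * w) by [].
apply: is_derive_eq; rewrite /GRing.scale/=; ring.
Qed.

Lemma F0E t : F0 W q t = m^-1 * mean P (fun x => W x * logistic r (t * W x)).
Proof.
rewrite /F0 !meanE -RintegralZl//; apply: eq_Rintegral => x _.
by rewrite /logistic [RHS]mulrA [_^-1 * _]mulrC.
Qed.

(** The differentiated integrand is at most [2 * W ^+ 2] in absolute value, so the finite second
    moment gives differentiability at every real [t]. *)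
Lemma is_derive_F0 (t : R) : is_derive t 1 (F0 W q) (derive1 (F0 W q) t).
Proof.
rewrite derive1E; apply: derivableP.
have -> : F0 W q = fun t => m^-1 * mean P (fun x => W x * logistic r (t * W x)).
  by apply/funext => s; exact: F0E.
apply: derivableM => //.
have [] // := is_derive_mean P (fun t x => W x * logistic r (t * W x))
  (fun t x => W x * (W x * dlogistic r (t * W x))) (fun x => 2 * W x ^+ 2)
  logistic_integrable _ _ _ t.
- move=> s x; have ? := is_derive_scale _ _ s (W x)
    (is_derive_logistic r r_ge2 (s * W x)).
  by apply: is_derive_eq; rewrite /GRing.scale/=; ring.
- exact: (integrableZl measurableT 2 W2_integrable).
- move=> s x; rewrite mulrA -expr2 normrM (ger0_norm (sqr_ge0 _)) mulrC.
  rewrite ler_wpM2r ?sqr_ge0//.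
exact: dlogistic_norm_le.
Qed.

Lemma F0_0 : F0 W q 0 = 0.
Proof.
rewrite F0E [X in _ * X]meanE (@eq_Rintegral _ _ _ P setT (fun=> 0)).
  by rewrite Rintegral_cst// mul0r mulr0.
by move=> x _; rewrite mul0r logistic_0 mulr0.
Qed.

Lemma F0_ge0 t : 0 <= t -> 0 <= F0 W q t.
Proof.
move=> t0; rewrite F0E mulr_ge0 ?invr_ge0 ?(ltW mean_gt0)// meanE.
by apply: Rintegral_ge0 => x _; rewrite mulr_ge0// logistic_ge0// mulr_ge0.
Qed.

Lemma F0_le1 t : F0 W q t <= 1.
Proof.
rewrite F0E -[leRHS](mulVf (lt0r_neq0 mean_gt0)) ler_pM2l ?invr_gt0 ?mean_gt0//.
rewrite !meanE.
apply: le_Rintegral => // x _; rewrite ler_piMr//.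
exact: le_trans (ler_norm _) (logistic_norm_le1 _ _ _).
Qed.

Let lnp_integrable t :
  P.-integrable setT (EFin \o (fun x => ln (expR (t * W x) + r - 1))).
Proof.
apply: (dominated_integrable _ _ (fun x => ln r + `|t| * W x)).
- apply: (measurableT_comp
    (is_derive_measurable _ _ _ (is_derive_log_partition r r_ge2))).
  exact: measurable_funM.
- move=> x; apply: le_trans (log_partition_norm_le _ r_ge2 _) _.
  by rewrite normrM (ger0_norm (W_ge0 x)).
- exact: (integrableD measurableT
    (finite_measure_integrable_cst P (ln r) measurableT)
    (integrableZl measurableT `|t| W_integrable)).
Qed.

Lemma is_derive_log_partition_mean (t : R) :
  is_derive t 1 L (m * (1 / r + (r - 1) / r * F0 W q t)).
Proof.
have := is_derive_mean P (fun t x => ln (expR (t * W x) + r - 1))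
  (fun t x => W x * (1 / r + (r - 1) / r * logistic r (t * W x))) W
  lnp_integrable _ W_integrable _ t.
have -> : mean P (fun x => W x * (1 / r + (r - 1) / r * logistic r (t * W x)))
   = m * (1 / r + (r - 1) / r * F0 W q t).
  rewrite F0E !meanE.
  rewrite (@eq_Rintegral _ _ _ P setT (fun x =>
    1 / r * W x + (r - 1) / r * (W x * logistic r (t * W x)))); last first.
    by move=> x _; ring.
  rewrite RintegralD//; last 2 first.
  - exact: (integrableZl measurableT (1 / r) W_integrable).
  - exact: (integrableZl measurableT ((r - 1) / r) (logistic_integrable t)).
  rewrite !RintegralZl// -meanE; field.
  by rewrite (lt0r_neq0 mean_gt0)/=; apply/eqP; have := r_ge2; lra.
apply.
- move=> s x.
  exact: (is_derive_scale (fun v => ln (expR v + r - 1))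
    (fun v => 1 / r + (r - 1) / r * logistic r v) s (W x)
    (is_derive_log_partition r r_ge2 (s * W x))).
(* The factor of [W] is a convex combination of 1 and a value of [logistic], so its norm is at most
   1. *)
- move=> s x; rewrite normrM (ger0_norm (W_ge0 x)) ler_piMr//.
  have := logistic_norm_le1 r r_ge2 (s * W x).
  have r2 := r_ge2; have r0 : 0 < r by lra.
  rewrite !ler_norml => /andP[l1 l2].
  have -> : 1 / r + (r - 1) / r * logistic r (s * W x) =
      (1 + (r - 1) * logistic r (s * W x)) / r.
    by ring.
  by rewrite ler_pdivrMr// ler_pdivlMr//; apply/andP; split; nra.
Qed.

Lemma is_derive_F0_primitive (t : R) : is_derive t 1 G (F0 W q t).
Proof.
have ? := is_derive_log_partition_mean t.
apply: is_derive_eq; rewrite /GRing.scale/=.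
have r2 := r_ge2.
field; rewrite (lt0r_neq0 mean_gt0)/=.
by apply/andP; split; apply/eqP; lra.
Qed.

Lemma log_partition_0 : L 0 = ln r.
Proof.
rewrite -[RHS](mean_cst P); congr (mean P _); apply/funext => x.
by rewrite mul0r expR0 [1 + r]addrC addrK.
Qed.

Lemma F0_primitive_0 : G 0 = 0.
Proof. by rewrite /F0_primitive log_partition_0; ring. Qed.

(** Dividing by [q] inside the logarithm subtracts [ln q], and [- t / q] completes the primitive.
    The zeros of [K] are thus the equal-area points of [F0]. *)
Lemma KE t : K W q t = (r - 1) / r * (G t - t * F0 W q t / 2).
Proof.
have r2 := r_ge2.
have den0 x : 0 < expR (t * W x) + r - 1 by have := expR_gt0 (t * W x); lra.
have ln_mean : mean P (fun x => ln ((expR (t * W x) + r - 1) / r)) = L t - ln r.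
  rewrite -[ln r in RHS](mean_cst P) /log_partition !meanE -RintegralB//;
    last first.
    exact: finite_measure_integrable_cst.
  by apply: eq_Rintegral => x _; rewrite ln_div ?posrE ?den0//; lra.
rewrite /K ln_mean.
rewrite /F0_primitive; field; rewrite (lt0r_neq0 mean_gt0)/=.
by apply/andP; split; apply/eqP; lra.
Qed.

(** The primitive absorbs the term linear in [s]. The coefficient in front is positive, so the
    maximizers are those of [G t - t ^+ 2 / (2 * b)] at [t = b * s]. *)
Lemma pressureE beta s (b := expR beta - 1) : 0 < b ->
  pressure W q beta s =
  m * (r - 1) / r * (G (b * s) - (b * s) ^+ 2 / (2 * b)) +
  (ln r + m * b / (2 * r)).
Proof.
move=> b0; have r2 := r_ge2.
rewrite /pressure -/b.
have -> : mean P (fun x => ln (expR (b * W x * s) + r - 1)) = L (b * s).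
  by congr (mean P _); apply/funext => x; rewrite mulrAC.
rewrite /F0_primitive; field; rewrite (lt0r_neq0 mean_gt0) (lt0r_neq0 b0)/= .
by apply/andP; split; apply/eqP; lra.
Qed.

End potts_functions.

(** * The phase transition in [beta] *)

Theorem theorem1p14 (d : measure_display) (T : measurableType d) (R : realType)
    (P : probability T R) (W : {RV P >-> R}) (q : nat)
    (W_ge0 : forall x : T, 0 <= W x)
    (EW_gt0 : (0 < 'E_P[W])%E)
    (W_tail : exists c tau : R, 0 < c /\ 2 < tau /\
       forall w : R, 1 <= w ->
         (P [set x | (w < W x)%R] <= (c * w `^ (- (tau - 1)))%:E)%E)
    (EW2_fin : ('E_P[(fun x => (W x ^+ 2)%R)] < +oo)%E)
    (q_ge3 : (3 <= q)%N)
    (F0_crossing : unique_zero_crossing W q) :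
  exists tc : R,
    (forall t : R, (0 < t /\ K W q t = 0) <-> t = tc) /\
    (forall betac : R, is_critical W q betac <->
       betac = ln (1 + tc / F0 W q tc)) /\
    (forall betac : R, is_critical W q betac ->
       forall s : R, is_nonzero_maximizer W q betac s <-> s = F0 W q tc).
Proof.
have q_ge2 : (2 <= q)%N by exact: ltnW.
have r_ge2 : 2 <= q%:R :> R by rewrite (ler_nat R 2).
have F1 := F0_le1 P W q W_ge0 EW_gt0 EW2_fin q_ge2.
set F := F0 W q; set G := F0_primitive W q.
have m0 := mean_gt0 P W W_ge0 EW_gt0 EW2_fin.
have [ts [ts_gt0 [convex concave]]] := F0_crossing.
have [||tc [[tc0 Ftc0 Gtc] tc_uniq tc_max super]] :=
  sigmoid_maxwell F (derive1 F) (derive1n 2 F) G ts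
  (is_derive_F0 P W q W_ge0 EW2_fin q_ge2)
  (is_derive_F0_primitive P W q W_ge0 EW_gt0 EW2_fin q_ge2)
  (F0_0 P W q W_ge0 EW2_fin q_ge2)
  (F0_primitive_0 P W q) (F0_ge0 P W q W_ge0 EW_gt0 EW2_fin q_ge2)
  (fun t _ => F1 t) ts_gt0.
- move=> t /andP[t0 tts]; have F2 := convex t t0 tts; split; last exact: F2.
  by apply: is_derive_derive1n2; exact: lt0r_neq0.
- move=> t tst; have F2 := concave t tst; split; last exact: F2.
  by apply: is_derive_derive1n2; exact: ltr0_neq0.
have Ftc1 : F tc <= 1 by exact: F1.
(* The critical value of [expR beta - 1]: the line [t / bc] is the equal-area chord, through the
   origin and [(tc, F tc)]. *)
pose bc := tc / F tc.
have bc0 : 0 < bc by exact: divr_gt0.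
have bcF : bc * F tc = tc by rewrite /bc divfK// gt_eqF.
pose Phi b t := G t - t ^+ 2 / (2 * b).
have Phi_0 b : Phi b 0 = 0 by rewrite /Phi /G F0_primitive_0; ring.
have maxE beta s : 0 < expR beta - 1 -> is_maximizer W q beta s <->
    0 <= s <= 1 /\ forall u, 0 <= u <= 1 ->
      Phi (expR beta - 1) ((expR beta - 1) * u) <=
      Phi (expR beta - 1) ((expR beta - 1) * s).
  move=> b0; have C0 : 0 < mean P W * (q%:R - 1) / q%:R.
    by rewrite divr_gt0 ?mulr_gt0//; lra.
  by split=> -[s01 smax]; split => // u /smax;
    rewrite !pressureE// lerD2r ler_pM2l.
(* The strict maximum of [G t / t ^+ 2] at [tc] is [1 / (2 * bc)]. The case [b = bc] is included for
   use at criticality. *)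
have Phi_sub b t : 0 < b -> b <= bc -> 0 < t -> t != tc -> Phi b t < 0.
  move=> b0 bbc t0 ttc; have := tc_max t t0 ttc.
  have -> : F tc / (2 * tc) = 1 / (2 * bc).
    by rewrite /bc; field; rewrite !gt_eqF.
  rewrite ltr_pdivrMr ?exprn_gt0// => Gt.
  rewrite subr_lt0 (lt_le_trans Gt)// mulrC ler_pM2l ?exprn_gt0//.
  by rewrite div1r lef_pV2 ?posrE; lra.
have Phi_tc : Phi bc tc = 0.
  by rewrite /Phi Gtc /bc; field; rewrite !gt_eqF.
have Phi_tc_lt b : 0 < b -> b < bc -> Phi b tc < 0.
  move=> b0 bbc; rewrite -Phi_tc /Phi ltrD2l ltrN2 ltr_pM2l ?exprn_gt0//.
  by rewrite ltf_pV2 ?posrE; lra.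
have subcrit beta s : 0 < expR beta - 1 -> expR beta - 1 < bc ->
    is_maximizer W q beta s <-> s = 0.
  set b := expR beta - 1 => b0 bbc.
  have neg t : 0 < t -> Phi b t < 0.
    move=> t0; have [->|ttc] := eqVneq t tc; first exact: Phi_tc_lt.
    by apply: Phi_sub => //; exact: ltW.
  rewrite maxE//; split=> [[/andP[s0 s1] smax]|->].
    apply/eqP; rewrite eq_le s0 andbT leNgt; apply/negP => s_gt0.
    have := smax 0; rewrite lexx ler01 mulr0 Phi_0 => /(_ isT).
    by rewrite leNgt neg// mulr_gt0.
  split; first by rewrite lexx ler01.
  move=> u /andP[]; rewrite le_eqVlt => /orP[/eqP <-//|u0 _].
  by rewrite mulr0 Phi_0 ltW// neg// mulr_gt0.
have supercrit beta : 0 < expR beta - 1 -> bc < expR beta - 1 ->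
    exists s0 : R, 0 < s0 /\ is_largest_solution W q beta s0 /\
       forall s : R, is_maximizer W q beta s <-> s = s0.
  set b := expR beta - 1 => b0 bbc.
  (* Under [t = b * s], the bound [t0 <= b] puts [t0 / b] in [[0, 1]], so the strict maximum over
     the half-line is also the one over [[0, 1]]. *)
  have [t0 [/andP[t00 t0b] Ft0 t0_largest t0_max]] := super b bbc.
  have bs0 : b * (t0 / b) = t0 by rewrite mulrC divfK// gt_eqF.
  exists (t0 / b); split; first exact: divr_gt0.
  split.
    split; first by rewrite ltW// divr_gt0.
    split; first by rewrite -/b bs0.
    move=> u u0 Fu; rewrite ler_pdivlMr// mulrC.
    apply: t0_largest; first by rewrite mulr_ge0// ltW.
    by rewrite -/b in Fu; rewrite /F Fu [b * _]mulrC mulfK// gt_eqF.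
  have s01 : 0 <= t0 / b <= 1.
    by rewrite divr_ge0 ?(ltW t00) ?(ltW b0)// ler_pdivrMr// mul1r.
  move=> s; rewrite maxE// -/b; split=> [[/andP[s0 s1] smax]|->].
    apply/eqP; rewrite eq_sym -subr_eq0; apply: contraT; rewrite subr_eq0 => ne.
    have := smax (t0 / b) s01; rewrite bs0 leNgt t0_max ?mulr_ge0 ?(ltW b0)//.
    by apply: contraNneq ne => <-; rewrite [b * _]mulrC mulfK// gt_eqF.
  split => // u /andP[u0 _]; rewrite bs0.
  have [->//|ne] := eqVneq (b * u) t0.
  by apply/ltW/t0_max => //; rewrite mulr_ge0// ltW.
have crit beta s : expR beta - 1 = bc ->
    is_maximizer W q beta s <-> s = 0 \/ s = F tc.
  move=> bE; rewrite maxE bE//.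
  (* At [bc] the maximum value is 0, attained only at 0 and [tc], that is, at [s = 0] and
     [s = tc / bc = F tc]. *)
  have le0 t : 0 <= t -> Phi bc t <= 0.
    rewrite le_eqVlt => /orP[/eqP <-|t0]; first by rewrite Phi_0.
    by have [->|ne] := eqVneq t tc; [rewrite Phi_tc|apply/ltW/Phi_sub].
  split=> [[/andP[s0 s1] smax]|].
    have := smax 0; rewrite lexx ler01 mulr0 Phi_0 => /(_ isT).
    have [->|s_neq0] := eqVneq s 0; first by left.
    have s_gt0 : 0 < s by rewrite lt_neqAle eq_sym s_neq0.
    have [bstc _|ne] := eqVneq (bc * s) tc; last first.
      by rewrite leNgt Phi_sub// mulr_gt0.
    right; apply: (@mulfI _ bc); first by rewrite gt_eqF.
    by rewrite bstc bcF.
  have le0u u : 0 <= u <= 1 -> Phi bc (bc * u) <= 0.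
    by move=> /andP[u0 _]; rewrite le0// mulr_ge0// ltW.
  case=> ->; first by rewrite mulr0 Phi_0 lexx ler01.
  by rewrite bcF Phi_tc Ftc1 (ltW Ftc0).
have bpos (beta : R) : 0 < beta -> 0 < expR beta - 1.
  by move=> beta0; rewrite subr_gt0 expR_gt1.
pose betac := ln (1 + bc).
have expbc : expR betac = 1 + bc by rewrite /betac lnK// posrE; lra.
have betac0 : 0 < betac by rewrite -expR_gt1 expbc; lra.
have betacE : expR betac - 1 = bc by rewrite expbc; lra.
have not_several beta s0 : (forall s, is_maximizer W q beta s <-> s = s0) ->
    ~ several_maximizers W q beta.
  by move=> max1 [s1 [s2 [ne [/max1 E1 /max1 E2]]]]; apply: ne; rewrite E1 E2.
(* Off the value [bc] of [expR beta - 1] the maximizer is unique, so coexistence fixes [beta]. *)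
have several_eq (beta : R) :
    0 < beta -> several_maximizers W q beta -> beta = betac.
  move=> beta0 sev; have [lt|gt|E] := ltgtP (expR beta - 1) bc.
  - by case: (not_several _ _ (fun s => subcrit beta s (bpos _ beta0) lt)).
  - by have [s0 [_ [_ /not_several /(_ sev)]]] :=
      supercrit beta (bpos _ beta0) gt.
  - by apply: expR_inj; rewrite expbc -E; lra.
exists tc; split; last split.
- have C0 : (q%:R - 1) / q%:R != 0 :> R by rewrite gt_eqF// divr_gt0//; lra.
  move=> t; rewrite (KE P W q W_ge0 EW_gt0 EW2_fin q_ge2); split.
    move=> [t0 /eqP]; rewrite mulf_eq0 (negbTE C0)/= subr_eq0 => /eqP.
    exact: tc_uniq.
  by move=> ->; split => //; rewrite -/G -/F Gtc subrr mulr0.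
- move=> beta; rewrite -/bc -/betac; split.
    by move=> [beta0 [sev _]]; exact: several_eq.
  move=> ->; split=> //; split; [|split=> //; split].
  + exists 0, (F tc); split; first by move=> E; move: Ftc0; rewrite -E ltxx.
    by rewrite !crit//; split; [left|right].
  + move=> b b0 bbc s; apply: subcrit; first exact: bpos.
    by rewrite -betacE ltrD2r ltr_expR.
  + move=> b bbc; apply: supercrit; first by apply: bpos; exact: lt_trans bbc.
    by rewrite -betacE ltrD2r ltr_expR.
move=> beta [beta0 [sev _]] s; rewrite (several_eq beta beta0 sev).
rewrite /is_nonzero_maximizer crit//; split.
  by case=> -[|].
by move=> ->; split; [right|apply/eqP; rewrite gt_eqF].
Qed.
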